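(* Let $\alpha,\beta\in(-\infty,1)$, let $T:\mathcal H\to\mathcal H$ be an $\alpha$-SPC and $U:\mathcal H\to\mathcal H$ be a $\beta$-SPC. (i) If $\alpha+\beta<\alpha\beta$, then $UT$ is a $\gamma^*$-SPC, where $\gamma^*:=\frac{\alpha\beta}{\alpha+\beta}$. Consequently, $UT$ satisfies the demi closedness principle. If, additionally, (a) $\alpha,\beta<0$, then $\gamma^*<0$; (b) $\alpha\beta<0$, then $\gamma^*\in(0,1)$. Moreover, if $\dim\mathcal H\ge2$, then the constant $\gamma^*$ is optimal, i.e. for arbitrary $\rho\in(-\infty,\gamma^* )$ there are an $\alpha$-SPC $T:\mathcal H\to\mathcal H$ and a $\beta$-SPC $U:\mathcal H\to\mathcal H$ such that $UT$ is not a $\rho$-SPC. (ii) If $\alpha+\beta<0$ and $\operatorname{Fix}T\cap\operatorname{Fix}U\neq\emptyset$, then $\operatorname{Fix}UT=\operatorname{Fix}T\cap\operatorname{Fix}U$. (iii) Suppose that $\alpha+\beta>\alpha\beta$. If $\alpha+\beta\le0$ and $\dim\mathcal H\ge2$, or if $\alpha+\beta>0$, then there are an $\alpha$-SPC $T:\mathcal H\to\mathcal H$ and a $\beta$-SPC $U:\mathcal H\to\mathcal H$ such that $UT$ is not an SPC. (iv) If $\alpha+\beta\ge0$, then there are an $\alpha$-SPC $T:\mathcal H\to\mathcal H$ and a $\beta$-SPC $U:\mathcal H\to\mathcal H$ such that $\operatorname{Fix}UT\neq\operatorname{Fix}T\cap\operatorname{Fix}U\neq\emptyset$.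
   Context: $\mathcal H$ is a real Hilbert space with $\mathcal H\neq\{0\}$; $UT$ denotes the composition $U\circ T$; $\operatorname{Fix}T:=\{z\in\mathcal H:T(z)=z\}$. For $\alpha\in(-\infty,1)$, an operator $T:\mathcal H\to\mathcal H$ is an $\alpha$-strict pseudocontraction ($\alpha$-SPC) if $\|T(x)-T(y)\|^2\le\|x-y\|^2+\alpha\|(T(x)-x)-(T(y)-y)\|^2$ for all $x,y\in\mathcal H$; it is an SPC if it is an $\alpha$-SPC for some $\alpha\in(-\infty,1)$. An operator $T$ satisfies the demi closedness principle if for any bounded sequence $\{x^k\}$ with $\|T(x^k)-x^k\|\to0$, every weak cluster point of $\{x^k\}$ belongs to $\operatorname{Fix}T$. *)

(* Defs.v *)
From HB Require Import structures.
From mathcomp Require Import all_boot all_order all_algebra.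
From mathcomp Require Import all_classical all_reals all_analysis.

Set Implicit Arguments.
Unset Strict Implicit.
Unset Printing Implicit Defensive.

Import Order.TTheory GRing.Theory Num.Theory.
Import numFieldNormedType.Exports.

Local Open Scope classical_set_scope.
Local Open Scope ring_scope.

(* A real Hilbert space is a complete normed R-module H together with a
   positive definite symmetric bilinear form inducing the norm of H. *)
Definition induces_norm (R : realType) (H : completeNormedModType R)
    (ip : {dot H for idfun}) : Prop :=
  forall x : H, `|x| ^+ 2 = ip x x.

(* dim H >= n, where H may be infinite-dimensional. *)
Definition dim_ge (R : realType) (H : completeNormedModType R) (n : nat)
    : Prop :=
  exists e : 'I_n -> H, forall c : 'I_n -> R,
    \sum_(i < n) c i *: e i = 0 -> forall i, c i = 0.

Definition Fix (R : realType) (H : completeNormedModType R) (T : H -> H)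
    : set H :=
  [set z | T z = z].

(* The standing requirement a < 1 is not part of this predicate; it is stated
   separately wherever it matters. *)
Definition strict_pseudocontraction (R : realType)
    (H : completeNormedModType R) (a : R) (T : H -> H) : Prop :=
  forall x y : H,
    `|T x - T y| ^+ 2
      <= `|x - y| ^+ 2 + a * `|(T x - x) - (T y - y)| ^+ 2.

Definition SPC (R : realType) (H : completeNormedModType R) (T : H -> H)
    : Prop :=
  exists2 a : R, a < 1 & strict_pseudocontraction a T.

(* The initial topology of this map is the weak topology of H: the coarsest one
   making every functional x |-> ip x y continuous, and by Riesz representation
   these are exactly the continuous linear functionals on H. *)
Definition weak_map (R : realType) (H : completeNormedModType R)
    (ip : {dot H for idfun}) : H -> {ptws H -> R} :=
  fun x y => ip x y.

Definition weak_cluster_points (R : realType) (H : completeNormedModType R)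
    (ip : {dot H for idfun}) (x : nat -> H) : set H :=
  cluster ((x : nat -> initial_topology (weak_map ip)) @ \oo).

Definition demiclosedness_principle (R : realType)
    (H : completeNormedModType R) (ip : {dot H for idfun}) (T : H -> H)
    : Prop :=
  forall x : nat -> H, bounded_fun x ->
    (fun k => `|T (x k) - x k|) @ \oo --> (0 : R) ->
    weak_cluster_points ip x `<=` Fix T.

(* Main.v *)
Require Import Defs.
From HB Require Import structures.
From mathcomp Require Import all_boot all_order all_algebra.
From mathcomp Require Import all_classical all_reals all_analysis.
From mathcomp Require Import ring lra.

Import Order.TTheory GRing.Theory Num.Theory.
Import numFieldNormedType.Exports.

Local Open Scope classical_set_scope.
Local Open Scope ring_scope.

(** For an operator [T] the displacement of a pair [x], [y] is
    [d = (T x - x) - (T y - y)].  Since [T x - T y = (x - y) + d], being an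
    [a]-SPC means [2 <x - y, d> + (1 - a) |d|^2 <= 0] ([SPC_ipP]); everything
    below is about displacements.

    Composition.  The displacement of [U \o T] is [u + v], with [u] the
    displacement of [T] at [x], [y] and [v] that of [U] at [T x], [T y], and the
    two defining inequalities add up to an excess of [a |u|^2 + b |v|^2].  When
    [a + b < 0], this is at most [(a b / (a + b)) |u + v|^2], because after
    multiplication by [a + b] the difference is [|a u - b v|^2] ([SPC_comp]).
    Demiclosedness holds for every SPC: the displacement of a term of the
    sequence and the cluster point [z] tends strongly to [- (T z - z)], so the
    inner product in [SPC_ipP] can be controlled with the weak topology ([SPC_demiclosed]).  If
    [x] is fixed by [U \o T] and compared with a common fixed point, then
    [v = - u] and the excess [(a + b) |u|^2] has to be nonnegative, whence
    [u = 0] when [a + b < 0] ([Fix_comp]).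

    Counterexamples.  On a plane identified with the complex numbers,
    multiplication by [1 + w], extended by the identity on the orthogonal
    complement, has displacement [w (x - y)] there and is a [k]-SPC if and only
    if [2 Re w + (1 - k) |w|^2 <= 0], i.e. [2 Re (1 / w) <= - (1 - k)] for
    [w != 0].  So the extreme [a]-SPCs of this kind are parametrized by
    [2 / w = - (1 - a) + i s] with [s] real.  For two of them, with parameters
    [A = - (1 - a) + i s] and [B = - (1 - b) + i r], the composition is of the
    same kind with [w = 2 (A + B + 2) / (A B)], and whether it is a [k]-SPC is
    governed by the quadratic form [2 s r + (1 - a) r^2 + (1 - b) s^2] in
    [(s, r)] ([exists_SPC_pair]).  On the line [(s, r) = m (a, b)] this form is
    [m^2 (a + b)^2 (1 - a b / (a + b))], which for large [m] makes the constant
    of the composition optimal ([SPC_comp_optimal]).  The form is indefinite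
    exactly when [a + b > a b], and far out in a direction where it is negative
    the composition is no [k]-SPC for any [k < 1] ([SPC_comp_not_SPC_dim2]).
    When [a + b] is nonnegative no plane is needed: [s = r = 0] gives homotheties
    of ratio [1 - 2 / (1 - a)], which live on any nonzero space
    ([SPC_comp_not_SPC], [Fix_comp_neq]). *)

(** * Strict pseudocontractions through displacements *)

Section Hilbert.
Context {R : realType} {H : completeNormedModType R} {ip : {dot H for idfun}}.
Hypothesis ip_norm : induces_norm ip.
Implicit Types (a b c k r s t : R) (T U : H -> H) (x y z u v d e f : H).

Lemma ipC u v : ip u v = ip v u.
Proof. by have := hermC ip u v; rewrite expr0 mul1r /=. Qed.

Lemma ipDr x u v : ip x (u + v) = ip x u + ip x v.
Proof. exact: linearDr. Qed.

Lemma ipDl x u v : ip (u + v) x = ip u x + ip v x.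
Proof. exact: linearDl. Qed.

Lemma ipBr x u v : ip x (u - v) = ip x u - ip x v.
Proof. exact: linearBr. Qed.

Lemma ipBl x u v : ip (u - v) x = ip u x - ip v x.
Proof. exact: linearBl. Qed.

Lemma ipNr x u : ip x (- u) = - ip x u.
Proof. exact: linearNr. Qed.

Lemma ipZr x a u : ip x (a *: u) = a * ip x u.
Proof. exact: linearZr_LR. Qed.

Lemma ipZl x a u : ip (a *: u) x = a * ip u x.
Proof. exact: linearZl_LR. Qed.

Lemma sqr_normD u v : `|u + v| ^+ 2 = `|u| ^+ 2 + 2 * ip u v + `|v| ^+ 2.
Proof.
by rewrite !ip_norm ipDl !ipDr (ipC v u); ring.
Qed.

(** Cauchy-Schwarz, which here is the triangle inequality squared, as the norm
    is already known to be one. *)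
Lemma ip_le u v : ip u v <= `|u| * `|v|.
Proof.
have : `|u + v| ^+ 2 <= (`|u| + `|v|) ^+ 2.
  by rewrite lerXn2r ?nnegrE ?addr_ge0 ?ler_normD.
rewrite sqr_normD; lra.
Qed.

Lemma displacement_subE T x y :
  T x - T y = (x - y) + ((T x - x) - (T y - y)).
Proof.
by rewrite [- (T y - y)]opprD [T x - x + _]addrACA -opprD [RHS]addrC subrK.
Qed.

Lemma SPC_ipP a T : strict_pseudocontraction a T <->
  forall x y, 2 * ip (x - y) ((T x - x) - (T y - y))
    + (1 - a) * `|(T x - x) - (T y - y)| ^+ 2 <= 0.
Proof.
split=> h x y; move: (h x y);
  by rewrite (displacement_subE T x y) (sqr_normD (x - y)); lra.
Qed.

(** A weighted Young inequality: for the displacements [u] and [v] of the two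
    steps, [(a + b) (a |u|^2 + b |v|^2) - a b |u + v|^2 = |a u - b v|^2 >= 0],
    and dividing by [a + b < 0] reverses the order. *)
Lemma SPC_comp a b T U : a + b < 0 ->
  strict_pseudocontraction a T -> strict_pseudocontraction b U ->
  strict_pseudocontraction (a * b / (a + b)) (U \o T).
Proof.
move=> ab_lt0 hT hU x y /=.
have := hU (T x) (T y); have := hT x y.
set u := (T x - x) - (T y - y).
set v := (U (T x) - T x) - (U (T y) - T y).
(* The displacements of the two steps telescope. *)
have -> : (U (T x) - x) - (U (T y) - y) = u + v.
  rewrite /u /v addrACA -opprD; congr (_ - _);
    by rewrite [RHS]addrC subrKA.
have : 0 <= `|a *: u - b *: v| ^+ 2 by apply: exprn_ge0.
rewrite (sqr_normD (a *: u)) normrN !normrZ !exprMn !real_normK ?num_real //.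
rewrite ipNr ipZl ipZr (sqr_normD u) => sq.
suff : a * `|u| ^+ 2 + b * `|v| ^+ 2
    <= a * b / (a + b) * (`|u| ^+ 2 + 2 * ip u v + `|v| ^+ 2) by lra.
rewrite mulrAC ler_ndivlMr //; lra.
Qed.

(** A point of [Fix (U \o T)] is moved by [T] and moved back by [U], so that the
    two squared displacements are equal and carry the total weight
    [a + b < 0]. *)
Lemma Fix_comp a b T U : a + b < 0 ->
  strict_pseudocontraction a T -> strict_pseudocontraction b U ->
  Fix T `&` Fix U !=set0 -> Fix (U \o T) = Fix T `&` Fix U.
Proof.
move=> ab_lt0 hT hU [z [Tz Uz]]; apply/seteqP; split=> x; last first.
  by move=> [Tx Ux]; rewrite /Fix /= Tx Ux.
move=> UTx; rewrite /Fix /= in Tz Uz UTx.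
have := hT x z; have := hU (T x) z.
rewrite Tz Uz UTx !subrr !subr0 (distrC x (T x)) => h1 h2.
have : 0 <= (a + b) * `|T x - x| ^+ 2 by lra.
rewrite nmulr_rge0 // => d0.
have : `|T x - x| ^+ 2 == 0 by rewrite eq_le d0 exprn_ge0.
rewrite expf_eq0 /= normr_eq0 subr_eq0 => /eqP Tx.
by split; rewrite /Fix //= -{1}Tx.
Qed.

(** * Demiclosedness *)

(** The only use made of the weak topology: a weak cluster point is approached
    infinitely often along each single functional [ip _ d]. *)
Lemma weak_cluster_frequently (x : nat -> H) z d (n : nat) k :
  weak_cluster_points ip x z -> 0 < k ->
  exists2 m, (n <= m)%N & `|ip z d - ip (x m) d| < k.
Proof.
move=> zx k0.
pose B : set (initial_topology (weak_map ip)) :=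
  weak_map ip @^-1` (fun g : {ptws H -> R} => `|ip z d - g d| < k).
have zB : nbhs (z : initial_topology (weak_map ip)) B.
  have zN : nbhs (weak_map ip z) (fun g : {ptws H -> R} => `|ip z d - g d| < k).
    have dB : nbhs (ip z d) (fun r : R => `|ip z d - r| < k).
      exact: (@nbhsx_ballx R R (ip z d) k).
    exact: (@proj_continuous H (fun=> R) d (weak_map ip z) _ dB).
  exact: (@initial_continuous _ _ (weak_map ip) z _ zN).
have xn : nbhs ((x : nat -> initial_topology (weak_map ip)) @ \oo)
    [set y | exists2 m, (n <= m)%N & y = x m].
  by exists n => // m nm; exists m.
by have [_ [[m nm ->] ?]] := zx _ _ xn zB; exists m.
Qed.

(** Write [w m = T (x m) - x m], which tends to [0], and [d = T z - z].  Then
    [SPC_ipP] at [x m], [z] reads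
    [(1 - a) |w m - d|^2 <= 2 <x m - z, d> - 2 <x m - z, w m>].  The last term
    tends to [0] because [x m] is bounded, and the one before it is infinitely
    often below any given positive number because [z] is a weak cluster point.
    Hence [(1 - a) |d|^2 <= 0]. *)
Lemma SPC_demiclosed a T : a < 1 -> strict_pseudocontraction a T ->
  demiclosedness_principle ip T.
Proof.
move=> a1 /SPC_ipP hT x [M [_ bx]] dx z zx.
pose C := `|M| + 1 + `|z|; pose d := T z - z.
have xC n : `|x n - z| <= C.
  apply: (le_trans (ler_normB _ _)); rewrite lerD2r.
  apply: bx => //; have := ler_norm M; lra.
have C0 : 0 <= C by exact: le_trans (xC 0%N).
have small k : 0 < k ->
    (1 - a) * `|d| ^+ 2 <= (2 * C + 2 + 2 * (1 - a) * `|d|) * k.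
  move=> k0; have /cvgr0Pnorm_lt /(_ _ k0) [n _ hn] := dx.
  have [m nm zm] := weak_cluster_frequently x z d n k zx k0.
  have := hn m nm; rewrite /= normr_id; set w := T (x m) - x m => wk.
  have := hT (x m) z; rewrite -/w -/d.
  have := xC m; set u := x m - z => uC.
  have ud : ip u d < k.
    rewrite /u ipBl; apply: le_lt_trans zm.
    by rewrite distrC ler_norm.
  have uw : - ip u w <= C * k.
    rewrite -ipNr; apply: (le_trans (ip_le _ _)); rewrite normrN.
    by apply: ler_pM => //; exact: ltW.
  have wd : `|d| ^+ 2 - 2 * `|d| * k <= `|w - d| ^+ 2.
    rewrite sqr_normD ipNr normrN.
    have := ip_le w d; have : `|w| * `|d| <= k * `|d|.
      by apply: ler_wpM2r => //; exact: ltW.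
    have : 0 <= `|w| ^+ 2 by apply: exprn_ge0.
    lra.
  have {}wd : (1 - a) * (`|d| ^+ 2 - 2 * `|d| * k) <= (1 - a) * `|w - d| ^+ 2.
    by apply: ler_wpM2l => //; rewrite subr_ge0 ltW.
  rewrite ipBr; lra.
suff /eqP : `|d| ^+ 2 = 0.
  by rewrite expf_eq0 /= normr_eq0 subr_eq0 => /eqP.
apply/eqP; rewrite eq_le exprn_ge0 // andbT.
have a1' : 0 < 1 - a by rewrite subr_gt0.
rewrite -(pmulr_rle0 _ a1'); apply/ler_addgt0Pr => k k0; rewrite add0r.
set D := 2 * C + 2 + 2 * (1 - a) * `|d| in small.
have D0 : 0 < D.
  have : 0 <= (1 - a) * `|d| by apply: mulr_ge0 => //; exact: ltW.
  rewrite /D; lra.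
by have := small _ (divr_gt0 k0 D0); rewrite [D * _]mulrC divfK ?gt_eqF.
Qed.

(** * Homotheties and complex multiplications *)

Lemma SPC_scaleP k t : (exists x : H, x != 0) ->
  strict_pseudocontraction k ( *:%R t : H -> H) <->
  (t - 1) * (2 + (1 - k) * (t - 1)) <= 0.
Proof.
move=> [v v0].
have key x y (D := t *: x - x - (t *: y - y)) :
    2 * ip (x - y) D + (1 - k) * `|D| ^+ 2
    = (t - 1) * (2 + (1 - k) * (t - 1)) * `|x - y| ^+ 2.
  have -> : D = (t - 1) *: (x - y) by rewrite scalerBr !scalerBl !scale1r.
  rewrite ipZr -ip_norm normrZ exprMn real_normK ?num_real //; ring.
rewrite SPC_ipP; split=> [/(_ v 0)|ht x y]; rewrite key.
  by rewrite subr0 pmulr_lle0 // exprn_gt0 // normr_gt0.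
by apply: mulr_le0_ge0 => //; exact: exprn_ge0.
Qed.

(** Multiplication by the complex number [1 + a + i b] on the plane spanned by
    the orthonormal pair [e], [f], with [e] as [1] and [f] as [i], and the
    identity on its orthogonal complement.  The parameters are those of the
    displacement [a + i b], since it is the displacement that decides on being
    a strict pseudocontraction. *)
Definition plane_shift e f a b x : H :=
  x + ((a * ip x e - b * ip x f) *: e + (b * ip x e + a * ip x f) *: f).

Section Plane.
Context {e f : H}.
Hypotheses (ee : ip e e = 1) (ff : ip f f = 1) (ef : ip e f = 0).

Lemma plane_shift_SPC k a b :
  strict_pseudocontraction k (plane_shift e f a b) <->
  2 * a + (1 - k) * (a ^+ 2 + b ^+ 2) <= 0.
Proof.
have fe : ip f e = 0 by rewrite ipC.
have key x y (D := plane_shift e f a b x - x - (plane_shift e f a b y - y)) :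
    2 * ip (x - y) D + (1 - k) * `|D| ^+ 2
    = (2 * a + (1 - k) * (a ^+ 2 + b ^+ 2))
      * (ip (x - y) e ^+ 2 + ip (x - y) f ^+ 2).
  have -> : D = (a * ip (x - y) e - b * ip (x - y) f) *: e
      + (b * ip (x - y) e + a * ip (x - y) f) *: f.
    rewrite /D /plane_shift ![_ + _ - x]addrC ![_ + _ - y]addrC !addKr.
    rewrite opprD addrACA -!scalerBl !ipBl.
    by congr (_ *: _ + _ *: _); ring.
  rewrite ip_norm !(ipDr, ipDl, ipZl, ipZr) ee ff ef fe; ring.
rewrite SPC_ipP; split=> [|h x y].
  move=> /(_ e 0); rewrite key subr0 ee ef; lra.
by rewrite key; apply: mulr_le0_ge0 => //; apply: addr_ge0; exact: sqr_ge0.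
Qed.

(** [(1 + w) (1 + w') = 1 + (w + w' + w w')] in real and imaginary parts. *)
Lemma plane_shift_comp a1 a2 b1 b2 :
  plane_shift e f b1 b2 \o plane_shift e f a1 a2 =
  plane_shift e f (a1 + b1 + a1 * b1 - a2 * b2) (a2 + b2 + a1 * b2 + a2 * b1).
Proof.
have fe : ip f e = 0 by rewrite ipC.
apply/funext => x /=; rewrite /plane_shift -addrA; congr (_ + _).
rewrite !(ipDl, ipZl) ee ff ef fe addrACA -!scalerDl.
by congr (_ *: _ + _ *: _); ring.
Qed.

End Plane.

(** Gram-Schmidt; [w] is the usual orthogonalized vector times [ip u u], which
    avoids a division. *)
Lemma dim_ge2_orthonormal : dim_ge H 2 ->
  exists e f, [/\ ip e e = 1, ip f f = 1 & ip e f = 0].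
Proof.
move=> [g g_free].
have unit v : v != 0 -> ip (`|v|^-1 *: v) (`|v|^-1 *: v) = 1.
  move=> v0; rewrite -ip_norm normrZ normfV normr_id mulVf ?expr1n //.
  by rewrite normr_eq0.
pose u := g ord0; pose v := g (lift ord0 ord0).
have indep a b : a *: u + b *: v = 0 -> a = 0 /\ b = 0.
  move=> h; have := g_free (fun i => if i == ord0 then a else b).
  rewrite !big_ord_recl big_ord0 addr0 /= => /(_ h) h'.
  by split; [exact: (h' ord0) | exact: (h' (lift ord0 ord0))].
have u0 : u != 0.
  apply/eqP => u0; have [] := indep 1 0; last by move/eqP; rewrite oner_eq0.
  by rewrite u0 scaler0 scale0r addr0.
pose w := ip u u *: v - ip u v *: u.
have uu : ip u u != 0 by rewrite -ip_norm expf_eq0 /= normr_eq0.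
have w0 : w != 0.
  apply/eqP => w0; have [] := indep (- ip u v) (ip u u).
    by rewrite scaleNr addrC.
  by move=> _ /eqP; rewrite (negPf uu).
exists (`|u|^-1 *: u), (`|w|^-1 *: w); split; [exact: unit|exact: unit|].
by rewrite ipZl ipZr ipBr !ipZr mulrC (mulrC (ip u u)) subrr !(mulr0, mul0r).
Qed.

(** The two operators are multiplications by [1 + 2 / A] and [1 + 2 / B] with
    [A = - (1 - a) + i s] and [B = - (1 - b) + i r]; the real parts make each
    of them satisfy its inequality with equality.  The composition is
    multiplication by [1 + w] with [w = 2 (A + B + 2) / (A B)], and the
    expression in the conclusion is
    [(2 Re w + (1 - k) |w|^2) |A B|^2 / 4]. *)
Lemma exists_SPC_pair a b r s : a < 1 -> b < 1 -> dim_ge H 2 ->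
  exists T U,
    [/\ strict_pseudocontraction a T,
        strict_pseudocontraction b U &
        forall k, strict_pseudocontraction k (U \o T) ->
          (a + b) * (1 - a) * (1 - b)
          - (2 * s * r + (1 - a) * r ^+ 2 + (1 - b) * s ^+ 2)
          + (1 - k) * ((a + b) ^+ 2 + (s + r) ^+ 2) <= 0].
Proof.
move=> a1 b1 /dim_ge2_orthonormal [e [f [ee ff ef]]].
pose p := 1 - a; pose q := 1 - b.
have p0 : 0 < p by rewrite subr_gt0.
have q0 : 0 < q by rewrite subr_gt0.
have ps0 : 0 < p ^+ 2 + s ^+ 2 by rewrite ltr_wpDr ?sqr_ge0 ?exprn_gt0.
have qr0 : 0 < q ^+ 2 + r ^+ 2 by rewrite ltr_wpDr ?sqr_ge0 ?exprn_gt0.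
have psN := lt0r_neq0 ps0; have qrN := lt0r_neq0 qr0.
have aE : a = 1 - p by rewrite /p; ring.
have bE : b = 1 - q by rewrite /q; ring.
(* With [A = - t1 + i t2], this is multiplication by [1 + 2 / A]. *)
pose V t1 t2 := plane_shift e f (- 2 * t1 / (t1 ^+ 2 + t2 ^+ 2))
                                (- 2 * t2 / (t1 ^+ 2 + t2 ^+ 2)).
exists (V p s), (V q r); split.
- apply/(plane_shift_SPC ee ff ef); rewrite [leLHS](_ : _ = 0) //.
  by rewrite aE; field.
- apply/(plane_shift_SPC ee ff ef); rewrite [leLHS](_ : _ = 0) //.
  by rewrite bE; field.
move=> k; rewrite (plane_shift_comp ee ff ef) => /(plane_shift_SPC ee ff ef).
have pqrs : 0 < (p ^+ 2 + s ^+ 2) * (q ^+ 2 + r ^+ 2) / 4.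
  by rewrite divr_gt0 ?mulr_gt0.
rewrite -(pmulr_rle0 _ pqrs); congr (_ <= _).
by rewrite aE bE; field; rewrite qrN psN.
Qed.

(** * Optimality and counterexamples *)

(** [a + b < a b] means [(1 - a) (1 - b) > 1], which for positive factors forces
    their sum to exceed [2]. *)
Lemma add_lt_mul_lt0 a b : a < 1 -> b < 1 -> a + b < a * b -> a + b < 0.
Proof. move=> a1 b1 ab; nra. Qed.

Lemma SPC_le a b T : a <= b ->
  strict_pseudocontraction a T -> strict_pseudocontraction b T.
Proof.
move=> ab hT x y; apply: (le_trans (hT x y)); rewrite lerD2l.
by apply: ler_wpM2r => //; exact: exprn_ge0.
Qed.

Lemma exists_mul_sqr_gt k c : 0 < k -> exists m, c < k * m ^+ 2.
Proof.
move=> k0; exists (1 + `|c| / k).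
have ck : 0 <= `|c| / k by rewrite divr_ge0 // ltW.
have -> : k * (1 + `|c| / k) ^+ 2 = k + 2 * `|c| + k * (`|c| / k) ^+ 2.
  by field; rewrite gt_eqF.
have : 0 <= k * (`|c| / k) ^+ 2 by rewrite mulr_ge0 ?sqr_ge0 // ltW.
have := ler_norm c; have := normr_ge0 c; lra.
Qed.

(** In [exists_SPC_pair] both the quadratic form and [(s + r)^2] grow
    quadratically, so the constant is decided by the minimum of their quotient.
    This minimum is attained at [(s, r)] proportional to [(a, b)] and equals
    [1 - a b / (a + b)]. *)
Lemma SPC_comp_optimal a b k : a < 1 -> b < 1 -> a + b < 0 -> dim_ge H 2 ->
  k < a * b / (a + b) ->
  exists T U, [/\ strict_pseudocontraction a T, strict_pseudocontraction b U &
                 ~ strict_pseudocontraction k (U \o T)].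
Proof.
move=> a1 b1 ab0 H2; set g := a * b / (a + b) => kg.
have abN : a + b != 0 by rewrite lt_eqF.
have K0 : 0 < (a + b) ^+ 2 * (g - k).
  by rewrite mulr_gt0 ?subr_gt0 // exprn_even_gt0.
have [m hm] := exists_mul_sqr_gt _
  (- ((a + b) * (1 - a) * (1 - b) + (1 - k) * (a + b) ^+ 2)) K0.
have [T [U [hT hU hUT]]] := exists_SPC_pair _ _ (b * m) (a * m) a1 b1 H2.
exists T, U; split=> // /hUT.
have -> : 2 * (a * m) * (b * m) + (1 - a) * (b * m) ^+ 2
    + (1 - b) * (a * m) ^+ 2 = (a + b) ^+ 2 * (1 - g) * m ^+ 2.
  by rewrite /g; field.
by rewrite -mulrDl exprMn; lra.
Qed.

(** At [(s, r) = m (1 - a, - 1)] the quadratic form of [exists_SPC_pair] equals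
    [- m^2 (1 - a) (a + b - a b)].  For large [m] it outweighs the constant
    term, and what is left is nonnegative for every [k < 1]: one choice of [m]
    defeats all [k] at once. *)
Lemma SPC_comp_not_SPC_dim2 a b : a < 1 -> b < 1 -> a * b < a + b ->
  dim_ge H 2 ->
  exists T U, [/\ strict_pseudocontraction a T, strict_pseudocontraction b U &
                 ~ SPC (U \o T)].
Proof.
move=> a1 b1 ab H2.
have K0 : 0 < (1 - a) * (a + b - a * b) by rewrite mulr_gt0 ?subr_gt0.
have [m hm] := exists_mul_sqr_gt _ (- ((a + b) * (1 - a) * (1 - b))) K0.
have [T [U [hT hU hUT]]] := exists_SPC_pair _ _ (- m) ((1 - a) * m) a1 b1 H2.
exists T, U; split=> // -[k k1 /hUT].
set S := (a + b) ^+ 2 + _.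
have : 0 <= (1 - k) * S.
  apply: mulr_ge0; first by rewrite subr_ge0 ltW.
  by apply: addr_ge0; exact: sqr_ge0.
lra.
Qed.

(** The homothety satisfying its inequality with equality; at [k = - 1] it is the
    zero map and at [k = 0] the reflection [- id]. *)
Lemma SPC_relaxed_reflection k : (exists x : H, x != 0) -> k < 1 ->
  strict_pseudocontraction k ( *:%R (1 - 2 / (1 - k)) : H -> H).
Proof.
move=> H0 k1; apply/(SPC_scaleP _ _ H0); rewrite [leLHS](_ : _ = 0) //.
by field; rewrite subr_eq0 gt_eqF.
Qed.

(** The product of the two ratios exceeds [1], and an expanding homothety is not
    an SPC because its displacement points in the direction of [x - y]. *)
Lemma SPC_comp_not_SPC a b : (exists x : H, x != 0) ->
  a < 1 -> b < 1 -> 0 < a + b ->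
  exists T U, [/\ strict_pseudocontraction a T, strict_pseudocontraction b U &
                 ~ SPC (U \o T)].
Proof.
move=> H0 a1 b1 ab.
exists ( *:%R (1 - 2 / (1 - a))), ( *:%R (1 - 2 / (1 - b))).
split; [exact: SPC_relaxed_reflection|exact: SPC_relaxed_reflection|].
have -> : ( *:%R (1 - 2 / (1 - b)) \o *:%R (1 - 2 / (1 - a)) : H -> H)
    = *:%R (1 + 2 * (a + b) / ((1 - a) * (1 - b))).
  apply/funext => x /=; rewrite scalerA; congr (_ *: _).
  by field; rewrite !subr_eq0 !gt_eqF.
move=> [k k1 /(SPC_scaleP _ _ H0)]; apply/negP; rewrite -ltNge addrAC subrr add0r.
set c := 2 * _ / _.
have c0 : 0 < c by rewrite !(divr_gt0, mulr_gt0) ?subr_gt0.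
by rewrite mulr_gt0 // addr_gt0 // mulr_gt0 // subr_gt0.
Qed.

(** The ratios [1 - 2 / (1 + b) = - (1 - b) / (1 + b)] and
    [1 - 2 / (1 - b) = - (1 + b) / (1 - b)] are inverse to each other, so the
    extreme homotheties for [- b] and [b] compose to the identity, although
    neither fixes a nonzero vector.  As [- b <= a], the first one is an
    [a]-SPC. *)
Lemma Fix_comp_neq a b : (exists x : H, x != 0) ->
  a < 1 -> b < 1 -> 0 <= a + b ->
  exists T U, [/\ strict_pseudocontraction a T, strict_pseudocontraction b U,
                 Fix (U \o T) <> Fix T `&` Fix U & Fix T `&` Fix U !=set0].
Proof.
move=> H0 a1 b1 ab; have [v v0] := H0.
have b0 : - b < 1 by lra.
have bN : 1 - - b != 0 by rewrite subr_eq0 gt_eqF.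
exists ( *:%R (1 - 2 / (1 - - b))), ( *:%R (1 - 2 / (1 - b))); split.
- by apply: (SPC_le (- b)); [lra | exact: SPC_relaxed_reflection].
- exact: SPC_relaxed_reflection.
- move=> Fix_eq; have : Fix ( *:%R (1 - 2 / (1 - b))
      \o *:%R (1 - 2 / (1 - - b)) : H -> H) v.
    rewrite /Fix /= scalerA -[RHS]scale1r; congr (_ *: _).
    by field; rewrite bN subr_eq0 gt_eqF.
  rewrite Fix_eq => -[+ _]; rewrite /Fix /= => /eqP.
  rewrite scalerBl scale1r -subr_eq0 addrAC subrr add0r oppr_eq0 scaler_eq0.
  by rewrite (negPf v0) orbF mulf_eq0 invr_eq0 (negPf bN) pnatr_eq0.
- by exists 0; split; rewrite /Fix /= scaler0.
Qed.

End Hilbert.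

(** * Compositions of two strict pseudocontractions *)

Theorem corollary3p7 (R : realType) (H : completeNormedModType R)
    (ip : {dot H for idfun}) (ip_norm : induces_norm ip)
    (H_neq0 : exists x : H, x != 0)
    (alpha beta : R) (alpha_lt1 : alpha < 1) (beta_lt1 : beta < 1)
    (T U : H -> H)
    (T_SPC : strict_pseudocontraction alpha T)
    (U_SPC : strict_pseudocontraction beta U) :
  (* (i) *)
  (alpha + beta < alpha * beta ->
    let gamma := alpha * beta / (alpha + beta) in
    [/\ gamma < 1 /\ strict_pseudocontraction gamma (U \o T),
        demiclosedness_principle ip (U \o T),
        (alpha < 0 /\ beta < 0 -> gamma < 0),
        (alpha * beta < 0 -> 0 < gamma /\ gamma < 1) &
        (dim_ge H 2 ->
          forall rho : R, rho < gamma ->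
            exists T' U' : H -> H,
              [/\ strict_pseudocontraction alpha T',
                  strict_pseudocontraction beta U' &
                  ~ strict_pseudocontraction rho (U' \o T')])])
  /\
  (* (ii) *)
  (alpha + beta < 0 -> Fix T `&` Fix U !=set0 ->
    Fix (U \o T) = Fix T `&` Fix U)
  /\
  (* (iii) *)
  (alpha + beta > alpha * beta ->
    (alpha + beta <= 0 /\ dim_ge H 2) \/ 0 < alpha + beta ->
    exists T' U' : H -> H,
      [/\ strict_pseudocontraction alpha T',
          strict_pseudocontraction beta U' &
          ~ SPC (U' \o T')])
  /\
  (* (iv) *)
  (0 <= alpha + beta ->
    exists T' U' : H -> H,
      [/\ strict_pseudocontraction alpha T',
          strict_pseudocontraction beta U',
          Fix (U' \o T') <> Fix T' `&` Fix U' &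
          Fix T' `&` Fix U' !=set0]).
Proof.
split=> [ab_lt gamma|].
  have ab_neg : alpha + beta < 0 by exact: add_lt_mul_lt0.
  have gamma_lt1 : gamma < 1 by rewrite /gamma ltr_ndivrMr // mul1r.
  have gamma_SPC : strict_pseudocontraction gamma (U \o T).
    exact: (SPC_comp ip_norm).
  split=> //.
  - exact: (SPC_demiclosed ip_norm _ _ gamma_lt1).
  - by move=> [a0 b0]; rewrite /gamma nmulr_llt0 ?invr_lt0 // nmulr_rgt0.
  - by move=> ab0; split=> //; rewrite /gamma nmulr_rgt0 ?invr_lt0.
  - by move=> H2 rho; exact: (SPC_comp_optimal ip_norm).
split; first by move=> ab_neg; exact: (Fix_comp _ _ _ _ ab_neg).
split=> [ab_gt [[_ H2]|ab_pos]|ab_ge0].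
- exact: (SPC_comp_not_SPC_dim2 ip_norm).
- exact: (SPC_comp_not_SPC ip_norm).
- exact: (Fix_comp_neq ip_norm).
Qed.
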